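(* A general ternary quartic $p \in H_4(\mathbb{C}^3)$ can be written as $$p(x_1,x_2,x_3) = q^2(x_1,x_2,x_3) + \sum_{k=1}^3 \ell_k^4(x_1,x_2,x_3),$$ where $q \in H_2(\mathbb{C}^3)$ and $\ell_1,\ell_2,\ell_3 \in H_1(\mathbb{C}^3)$.
   Context: $H_d(\mathbb{C}^n)$ denotes the complex vector space of homogeneous polynomials of degree $d$ in $n$ variables. ''A general $p$ has property P'' means P holds for all $p$ in a nonempty Zariski-open subset of $H_d(\mathbb{C}^n)$. *)

(* Defs.v *)
From HB Require Import structures.
From mathcomp Require Import all_boot all_order all_algebra.
Set Implicit Arguments. Unset Strict Implicit. Unset Printing Implicit Defensive.
Import Order.TTheory GRing.Theory Num.Theory.
Local Open Scope ring_scope.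

(* Multivariate polynomials in n variables over R, as iterated univariate
   polynomials: MP R 0 = R, MP R n.+1 = (MP R n)[x_{n+1}]. *)
Fixpoint MP (R : comNzRingType) (n : nat) : comNzRingType :=
  if n is n'.+1 then ({poly MP R n'} : comNzRingType) else R.

(* [homog p d]: p is homogeneous of total degree d (the zero polynomial is
   homogeneous of every degree, so that H_d is a vector space). *)
Fixpoint homog (R : comNzRingType) (n : nat) : MP R n -> nat -> bool :=
  match n return MP R n -> nat -> bool with
  | 0 => fun p d => (d == 0%N) || (p == 0)
  | n'.+1 => fun (p : {poly MP R n'}) d =>
      all (fun i => (p`_i == 0) || ((i <= d)%N && homog p`_i (d - i)))
          (iota 0 (size p))
  end.

(* Coefficient of p at the exponent vector e (missing entries read as 0). *)
Fixpoint mcoef (R : comNzRingType) (n : nat) : MP R n -> seq nat -> R :=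
  match n return MP R n -> seq nat -> R with
  | 0 => fun p _ => p
  | n'.+1 => fun (p : {poly MP R n'}) e => mcoef p`_(head 0%N e) (behead e)
  end.

(* Polynomial functions on the coefficient space: polynomial expressions
   in the coordinate functionals p |-> (coefficient of a monomial of p). *)
Inductive pfun (R : comNzRingType) : Type :=
  | PConst of R
  | PCoef of seq nat
  | PAdd of pfun R & pfun R
  | PMul of pfun R & pfun R.

Fixpoint peval (R : comNzRingType) (n : nat) (F : pfun R) (p : MP R n) : R :=
  match F with
  | PConst c => c
  | PCoef e => mcoef p e
  | PAdd F1 F2 => peval F1 p + peval F2 p
  | PMul F1 F2 => peval F1 p * peval F2 p
  end.

(* The Zariski-open subset of H_d(R^n) given by a finite family Fs of
   polynomial functions: U = H_d \ V(Fs) = {p in H_d | some F in Fs, F p <> 0}. *)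
Definition zopen_mem (R : comNzRingType) (n d : nat) (Fs : seq (pfun R))
  (p : MP R n) : Prop :=
  homog p d /\ has (fun F => peval F p != 0) Fs.

Definition general (R : comNzRingType) (n : nat) (d : nat) (P : MP R n -> Prop) : Prop :=
  exists Fs : seq (pfun R),
    (exists p0 : MP R n, zopen_mem d Fs p0) /\
    (forall p, zopen_mem d Fs p -> P p).
Arguments general R n d P : clear implicits.

(* Main.v *)
Require Import Defs.
From HB Require Import structures.
From mathcomp Require Import all_boot all_order all_algebra.
From mathcomp Require Import closed_field ring zify.
From Stdlib Require Import Classical.
Import GRing.Theory Num.Theory.
Set Implicit Arguments. Unset Strict Implicit. Unset Printing Implicit Defensive.
Local Open Scope ring_scope.

(* Both the parameters (q, l1, l2, l3) and the quartics form 15-dimensional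
   spaces.  By quantifier elimination the image of (q, l1, l2, l3) |->
   q^2 + l1^4 + l2^4 + l3^4 is constructible, so it either contains a nonempty
   open set or lies in a hypersurface.  The latter is impossible because the
   differential (q', l') |-> 2 q q' + 4 (l1^3 l1' + l2^3 l2' + l3^3 l3') is onto
   at q = XY + XZ + YZ, (l1, l2, l3) = (X, Y, Z): the multiples of X^3, Y^3, Z^3
   give every monomial having an exponent at least 3, and q times the quadratic
   monomials gives the six others. *)

(** * Polynomials determined by their values, and evaluation of formal terms *)

Lemma horner_ext_eq0 (K : numDomainType) (p : {poly K}) :
  (forall t, p.[t] = 0) -> p = 0.
Proof.
move=> p0; apply/eqP/negP => /negP nz.
(* In characteristic zero the naturals below [size p] are distinct, one root too many for a nonzero
   [p]. *)
have := @max_poly_roots K p [seq i%:R | i <- iota 0 (size p)] nz.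
rewrite size_map size_iota ltnn => H; suff: false by []; apply: H.
  by apply/allP => x _; rewrite /root p0.
by rewrite map_inj_uniq ?iota_uniq // => i j /eqP; rewrite eqr_nat => /eqP.
Qed.

Section TermEval.
Variable K : comUnitRingType.

(* The value at inverses is junk. *)
Fixpoint teval (A : comNzRingType) (phi : K -> A) (x : nat -> A)
    (t : GRing.term K) : A :=
  match t with
  | GRing.Var i => x i
  | GRing.Const c => phi c
  | GRing.NatConst n => n%:R
  | GRing.Add t1 t2 => teval phi x t1 + teval phi x t2
  | GRing.Opp t1 => - teval phi x t1
  | GRing.NatMul t1 n => teval phi x t1 *+ n
  | GRing.Mul t1 t2 => teval phi x t1 * teval phi x t2
  | GRing.Inv _ => 0
  | GRing.Exp t1 n => teval phi x t1 ^+ n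
  end.

(** With [horner_eval] as [h], this lets a term be restricted to a line or a curve and then
    specialised at a parameter. *)
Lemma rmorph_teval (A B : comNzRingType) (h : {rmorphism A -> B})
    (phi : K -> A) (psi : K -> B) (x : nat -> A) (y : nat -> B) t :
  h \o phi =1 psi -> h \o x =1 y -> h (teval phi x t) = teval psi y t.
Proof.
move=> hphi hx; elim: t => //=.
- by move=> n; rewrite rmorph_nat.
- by move=> t1 IH1 t2 IH2; rewrite rmorphD IH1 IH2.
- by move=> t IH; rewrite rmorphN IH.
- by move=> t IH n; rewrite rmorphMn IH.
- by move=> t1 IH1 t2 IH2; rewrite rmorphM IH1 IH2.
- by move=> t _; rewrite rmorph0.
- by move=> t IH n; rewrite rmorphXn IH.
Qed.

Lemma eq_teval (x y : nat -> K) t : x =1 y -> teval id x t = teval id y t.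
Proof. by move=> xy; exact: (@rmorph_teval _ _ idfun). Qed.

Lemma eval_teval (e : seq K) t :
  GRing.rterm t -> GRing.eval e t = teval id (nth 0 e) t.
Proof.
elim: t => //=.
- by move=> t1 IH1 t2 IH2 /andP[/IH1-> /IH2->].
- by move=> t IH /IH->.
- by move=> t IH n /IH->.
- by move=> t1 IH1 t2 IH2 /andP[/IH1-> /IH2->].
- by move=> t IH n /IH->.
Qed.

End TermEval.

(** * Density in affine space and constructible sets *)

Section Density.
Variable K : numFieldType.
Implicit Types (t : GRing.term K) (x z b : nat -> K).
Local Notation ev x t := (teval id x t).
Local Notation evC x t := (teval polyC x t).

Lemma horner_teval (x : nat -> {poly K}) t s :
  (evC x t).[s] = ev (fun i => (x i).[s]) t.
Proof.
apply: (@rmorph_teval _ _ _ (horner_eval s)) => // c.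
by rewrite /= /horner_eval hornerC.
Qed.

(** Points of K^n are encoded as infinite sequences so that terms can be evaluated without bounding
    their variables. *)
Definition supported n x := forall i, (n <= i)%N -> x i = 0.

(** Affine space is irreducible: on the line [l] joining [x1] to [x2] both terms become nonzero
    polynomials in one variable, and so does their product, which therefore has a nonzero value. *)
Lemma teval_mul_neq0 n t1 t2 x1 x2 :
  supported n x1 -> supported n x2 -> ev x1 t1 != 0 -> ev x2 t2 != 0 ->
  exists2 x, supported n x & ev x (GRing.Mul t1 t2) != 0.
Proof.
move=> s1 s2 nz1 nz2; pose l i : {poly K} := (x1 i)%:P + (x2 i - x1 i)%:P * 'X.
have l0 i : (l i).[0] = x1 i by rewrite /l !hornerE.
have l1 i : (l i).[1] = x2 i.
  by rewrite /l hornerD hornerM !hornerC hornerX mulr1 addrC subrK.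
have: evC l t1 * evC l t2 != 0.
  rewrite mulf_neq0 //; apply/eqP => E.
  - by move: nz1; rewrite -(eq_teval t1 l0) -horner_teval E horner0 eqxx.
  - by move: nz2; rewrite -(eq_teval t2 l1) -horner_teval E horner0 eqxx.
move=> nz; apply: NNPP => H; case/eqP: nz; apply: horner_ext_eq0 => s.
apply/eqP/negP => /negP nz; apply: H; exists (fun i => (l i).[s]).
  by move=> i ni; rewrite /l s1 // s2 // subrr mul0r addr0 hornerC.
by rewrite /= -!horner_teval -hornerM.
Qed.

(* Compare lowest-order terms at b: if G (b + s z) has order m in s for some z,
   with m minimal, then along the curve with velocity z the s^m-coefficient
   is unchanged, so G does not vanish on the curve. *)
Lemma dense_of_curves n (S : (nat -> K) -> Prop) b :
  supported n b ->
  (forall z, supported n z -> exists w : nat -> {poly K},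
     [/\ forall i, (w i).[0] = z i,
         forall s, supported n (fun i => (w i).[s])
       & forall s, S (fun i => b i + s * (w i).[s])]) ->
  forall G, (forall x, S x -> ev x G = 0) ->
  forall x, supported n x -> ev x G = 0.
Proof.
move=> sb curve G G0.
pose H z := evC (fun i => (b i)%:P + (z i)%:P * 'X) G.
suff H0 m : forall z, supported n z -> (H z)`_m = 0.
  move=> x sx; pose z i := x i - b i.
  have sz : supported n z by move=> i ni; rewrite /z sb // sx // subrr.
  have := horner_teval (fun i => (b i)%:P + (z i)%:P * 'X) G 1.
  have -> : evC (fun i => (b i)%:P + (z i)%:P * 'X) G = 0.
    by apply/polyP => m; rewrite coef0 H0.
  rewrite horner0 => ->; apply: eq_teval => i.
  by rewrite hornerD hornerM !hornerC hornerX mulr1 /z addrC subrK.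
elim/ltn_ind: m => m IH z sz.
have [w [w0 sw Sw]] := curve z sz.
(* [P] is G(b + X w(u)), with u the inner variable and X the outer one. Fixing u gives [H] in the
   direction w(u); setting X = u gives [G] along the curve. *)
pose P : {poly {poly K}} :=
  teval (polyC \o polyC) (fun i => (b i)%:P%:P + (w i)%:P * 'X) G.
have HP s : map_poly (horner_eval s) P = H (fun i => (w i).[s]).
  apply: rmorph_teval => [c | i] /=.
    by rewrite map_polyC /= /horner_eval hornerC.
  rewrite rmorphD rmorphM /= !map_polyC /= map_polyX /=.
  by rewrite /horner_eval hornerC.
have Pk k : (k < m)%N -> P`_k = 0.
  move=> km; apply: horner_ext_eq0 => t.
  rewrite -(IH k km (fun i => (w i).[t])) ?sw //.
  by rewrite -HP coef_map.
have PX : P.['X] = 0.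
  apply: horner_ext_eq0 => t; rewrite -[RHS](G0 _ (Sw t)).
  apply: (@rmorph_teval _ _ _ (horner_eval t \o horner_eval 'X)) => [c|i] /=.
    by rewrite /horner_eval !hornerE.
  rewrite /horner_eval !(hornerD, hornerM, hornerC, hornerX).
  by rewrite mulrC.
(* After division by X^m, setting X = u still gives 0; then u = 0 leaves the coefficient of order m
   in the direction w(0) = z. *)
have PQ : P = drop_poly m P * 'X^m.
  rewrite -{1}(poly_take_drop m P) [take_poly m P](_ : _ = 0) ?add0r //.
  by apply/polyP => k; rewrite coef_take_poly coef0; case: ifP => // /Pk.
have QX : (drop_poly m P).['X] = 0.
  move: PX; rewrite {1}PQ hornerM hornerXn => /eqP.
  by rewrite mulf_eq0 expf_eq0 polyX_eq0 andbF orbF => /eqP.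
have <- : H (fun i => (w i).[0]) = H z.
  rewrite -[RHS](@rmorph_teval _ _ _ idfun polyC _
     (fun i => (b i)%:P + ((w i).[0])%:P * 'X)) // => i /=.
  by rewrite w0.
rewrite -HP coef_map /= /horner_eval.
have := horner_map (horner_eval (0 : K)) (drop_poly m P) 'X.
rewrite QX rmorph0 /= {2}/horner_eval hornerX !horner_coef0 coef_map /=.
by rewrite /horner_eval coef_drop_poly horner_coef0.
Qed.

(** Induction on the blocks of the union: a block either lies in a hypersurface, which is multiplied
    into [G], or all its equations are trivial and it is open. *)
Lemma dnf_dichotomy n (D : seq (seq (GRing.term K) * seq (GRing.term K))) :
  let holdsD x := has (fun bc => all (fun t => ev x t == 0) bc.1 &&
                                 all (fun t => ev x t != 0) bc.2) D in
  all (@GRing.dnf_rterm K) D ->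
  exists G, [/\ GRing.rterm G, exists2 x, supported n x & ev x G != 0 &
    (forall x, supported n x -> ev x G != 0 -> holdsD x) \/
    (forall x, supported n x -> holdsD x -> ev x G = 0)].
Proof.
move=> holdsD0; rewrite {}/holdsD0; elim: D => [_|[ts us] D IH].
  exists (GRing.Const 1); split=> //; last by right.
  by exists (fun=> 0) => //=; rewrite oner_neq0.
rewrite [all _ _]/=; case/andP => /andP[/= rts rus].
move=> /IH [G [rG [x0 sx0 nzG] [HG|HG]]] {IH}.
  exists G; split => //; first by exists x0.
  by left=> x sx nz; rewrite /= HG ?orbT.
have [[i [ilt [x1 sx1 nz1]]]|ts0] := classic (exists i, (i < size ts)%N /\
    exists2 x, supported n x & ev x (nth (GRing.Const 0) ts i) != 0).
  exists (GRing.Mul (nth (GRing.Const 0) ts i) G); split.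
  - by rewrite /= rG andbT; apply: (all_nthP _ rts).
  - exact: teval_mul_neq0 nz1 nzG.
  right=> x sx /orP[/andP[/(all_nthP (GRing.Const 0)) /(_ i ilt) /eqP E _]|].
    by rewrite /= E mul0r.
  by move/(HG x sx) => E; rewrite /= E mulr0.
(* All equations of the block hold identically here, so the block is the open set where the product
   [U] of its inequations is nonzero. *)
pose U := foldr (@GRing.Mul K) (GRing.Const 1) us.
have evU x : (ev x U != 0) = all (fun t => ev x t != 0) us.
  rewrite /U; elim: (us) => /= [|u s <-]; first by rewrite oner_neq0.
  by rewrite mulf_eq0 negb_or.
have [[x1 sx1 nz1]|us0] := classic (exists2 x, supported n x & ev x U != 0).
  exists U; split; [|by exists x1|left].
    by rewrite /U; elim: (us) rus => //= u s IH /andP[-> /IH].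
  move=> x sx nz; rewrite /= -evU nz andbT; apply/orP; left.
  apply/(all_nthP (GRing.Const 0)) => i ilt; apply/negP => /negP nzi.
  by apply: ts0; exists i; split=> //; exists x.
exists G; split=> //; first by exists x0.
right=> x sx /orP[/andP[_ ]|]; last exact: HG.
by rewrite -evU => nz; case: us0; exists x.
Qed.

End Density.

(** Chevalley's theorem in logical form: definable sets are constructible. *)
Lemma closed_field_qe (F : closedFieldType) (f : GRing.formula F) :
  GRing.rformula f ->
  exists2 D, all (@GRing.dnf_rterm F) D &
    forall e, GRing.holds e f <->
      has (fun bc => all (fun t => GRing.eval e t == 0) bc.1 &&
                     all (fun t => GRing.eval e t != 0) bc.2) D.
Proof.
move=> rf.
have ok := ClosedFieldQE.holds_ex_elim (@solve_monicpoly F).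
have wf := @ClosedFieldQE.wf_ex_elim F.
pose g := GRing.quantifier_elim (@ClosedFieldQE.ex_elim F) f.
have rg : GRing.qf_form g && GRing.rformula g by apply: GRing.quantifier_elim_wf.
exists (GRing.qf_to_dnf g false).
  by apply: GRing.qf_to_dnf_rterm; case/andP: rg.
move=> e; have P := GRing.quantifier_elim_rformP wf ok e rf.
rewrite -/g -GRing.qf_to_dnfP // in P.
rewrite (rwP P); set D := GRing.qf_to_dnf _ _.
suff -> : GRing.qf_eval e (GRing.dnf_to_form D) =
   has (fun bc => all (fun t => GRing.eval e t == 0) bc.1 &&
                     all (fun t => GRing.eval e t != 0) bc.2) D by [].
elim: D => //= -[ts us] D ->; congr (_ && _ || _) => /=.
  by elim: ts => //= t ts ->.
by elim: us => //= t us ->.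
Qed.

(** * The parametrization in coordinates and its image as a first-order formula *)

Definition quartic_exps : seq (seq nat) :=
  [:: [:: 4; 0; 0]; [:: 0; 4; 0]; [:: 0; 0; 4];
      [:: 3; 1; 0]; [:: 3; 0; 1]; [:: 1; 3; 0];
      [:: 0; 3; 1]; [:: 1; 0; 3]; [:: 0; 1; 3];
      [:: 2; 2; 0]; [:: 2; 0; 2]; [:: 0; 2; 2];
      [:: 2; 1; 1]; [:: 1; 2; 1]; [:: 1; 1; 2]]%N.

(* Coefficients, in the order of [quartic_exps], of
     (y0 X^2 + y1 Y^2 + y2 Z^2 + y3 XY + y4 XZ + y5 YZ)^2
       + (y6 X + y7 Y + y8 Z)^4 + (y9 X + y10 Y + y11 Z)^4
       + (y12 X + y13 Y + y14 Z)^4.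
   The operations are parameters so that the same formulas can be read both in
   a ring and as formal terms. *)
Section QuarticCoefficients.
Local Open Scope nat_scope.
Variables (T : Type) (zero : T) (add mul : T -> T -> T) (natmul : T -> nat -> T)
  (exp : T -> nat -> T).

Definition quart (y : nat -> T) (i : nat) : T :=
  let sum3 m a b c :=
    natmul (add (add
      (mul (exp (y 6) a) (mul (exp (y 7) b) (exp (y 8) c)))
      (mul (exp (y 9) a) (mul (exp (y 10) b) (exp (y 11) c))))
      (mul (exp (y 12) a) (mul (exp (y 13) b) (exp (y 14) c)))) m in
  let dbl s t := natmul (mul (y s) (y t)) 2 in
  nth zero
   [:: add (mul (y 0) (y 0)) (sum3 1 4 0 0);
       add (mul (y 1) (y 1)) (sum3 1 0 4 0);
       add (mul (y 2) (y 2)) (sum3 1 0 0 4);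
       add (dbl 0 3) (sum3 4 3 1 0);
       add (dbl 0 4) (sum3 4 3 0 1);
       add (dbl 1 3) (sum3 4 1 3 0);
       add (dbl 1 5) (sum3 4 0 3 1);
       add (dbl 2 4) (sum3 4 1 0 3);
       add (dbl 2 5) (sum3 4 0 1 3);
       add (add (mul (y 3) (y 3)) (dbl 0 1)) (sum3 6 2 2 0);
       add (add (mul (y 4) (y 4)) (dbl 0 2)) (sum3 6 2 0 2);
       add (add (mul (y 5) (y 5)) (dbl 1 2)) (sum3 6 0 2 2);
       add (add (dbl 0 5) (dbl 3 4)) (sum3 12 2 1 1);
       add (add (dbl 1 4) (dbl 3 5)) (sum3 12 1 2 1);
       add (add (dbl 2 3) (dbl 4 5)) (sum3 12 1 1 2)] i.
End QuarticCoefficients.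

Definition quartR (A : nzRingType) : (nat -> A) -> nat -> A :=
  quart 0%R +%R *%R (@GRing.natmul A) (@GRing.exp A).
Definition quartT (A : nzRingType) :
    (nat -> GRing.term A) -> nat -> GRing.term A :=
  quart (GRing.NatConst A 0) (@GRing.Add A) (@GRing.Mul A) (@GRing.NatMul A)
        (@GRing.Exp A).

Lemma rmorph_quartR (A B : nzRingType) (h : {rmorphism A -> B}) y x i :
  h \o y =1 x -> h (quartR y i) = quartR x i.
Proof.
move=> hy.
have hX m n k a b c : h (y a ^+ m * (y b ^+ n * y c ^+ k)) =
   x a ^+ m * (x b ^+ n * x c ^+ k) by rewrite !(rmorphM, rmorphXn) /= -!hy.
have hM a b : h (y a * y b) = x a * x b by rewrite rmorphM -!hy.
rewrite /quartR /quart.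
do 15![case: i => [|i];
  first by cbn [nth]; rewrite ?(rmorphD, rmorphMn, hX, hM)].
by rewrite !nth_default // rmorph0.
Qed.

(** Variables 0 to 14 stand for the coefficients of the quartic, variables 15 to 29 for the
    parameters. *)
Definition quart_formula (A : nzRingType) : GRing.formula A :=
  foldr GRing.Exists
    (foldr GRing.And (GRing.Bool true)
      [seq GRing.Equal (GRing.Var _ i)
           (quartT (fun j => GRing.Var _ (15 + j)) i) | i <- iota 0 15])
    (iota 15 15).

Lemma quart_formula_rformula (A : unitRingType) :
  GRing.rformula (quart_formula A).
Proof. by []. Qed.

Lemma eval_quartT (A : unitRingType) (e : seq A) (y : nat -> GRing.term A) i :
  GRing.eval e (quartT y i) = quartR (fun j => GRing.eval e (y j)) i.
Proof.
do 15![case: i => [|i]; first by []].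
by rewrite /quartT /quartR /quart !nth_default.
Qed.

Lemma holds_conj (A : unitRingType) (I : eqType) (e : seq A)
    (g : I -> GRing.formula A) (s : seq I) :
  GRing.holds e (foldr GRing.And (GRing.Bool true) [seq g i | i <- s]) <->
  {in s, forall i, GRing.holds e (g i)}.
Proof.
elim: s => [|i s IH] //=; split=> [[gi /IH gs] j|gs].
  by rewrite inE => /predU1P[->|/gs].
split; first by apply: gs; rewrite mem_head.
by apply/IH => j js; apply: gs; rewrite inE js orbT.
Qed.

Lemma quart_formulaP (A : unitRingType) (x : nat -> A) :
  GRing.holds (mkseq x 15) (quart_formula A) <->
  exists y, forall i, (i < 15)%N -> x i = quartR y i.
Proof.
have out i : (i \in [predC iota 15 15]) = ~~ (15 <= i < 30)%N.
  by rewrite -[LHS]/(~~ (i \in iota 15 15)) mem_iota.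
split.
  case/GRing.foldExistsP => e E /holds_conj H.
  exists (fun j => e`_(15 + j)) => i lt_i.
  have -> : x i = e`_i.
    by rewrite -E ?nth_mkseq // out negb_and -ltnNge lt_i.
  have := H i; rewrite mem_iota => Hi.
  exact: etrans (Hi lt_i) (eval_quartT _ _ _).
case=> y H; apply/GRing.foldExistsP.
exists (mkseq x 15 ++ mkseq y 15).
  move=> i; rewrite out nth_cat size_mkseq negb_and -ltnNge -leqNgt.
  case: ltnP => // le_i /= le_i2.
  by rewrite [LHS]nth_default ?[RHS]nth_default // size_mkseq leq_subRL.
apply/holds_conj => i; rewrite mem_iota => /andP[_ lt_i].
apply: etrans (esym (eval_quartT _ _ _)).
by rewrite -[LHS]/((mkseq x 15 ++ mkseq y 15)`_i) nth_cat size_mkseq lt_i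
  nth_mkseq // H.
Qed.

(** * Curves in the image, from surjectivity of the differential *)

Section Curves.
Variable K : numFieldType.

(* The point q = XY + XZ + YZ, (l1, l2, l3) = (X, Y, Z). *)
Definition base_point : nat -> K :=
  nth 0 [:: 0; 0; 0; 1; 1; 1; 1; 0; 0; 0; 1; 0; 0; 0; 1].

(** The image of a line through [base_point] is a curve as required by [dense_of_curves], once its
    direction [v] is mapped to [z] by the differential. The system for [v] is triangular: the
    coefficients of X^2Y^2, X^2Z^2, Y^2Z^2 fix the mixed terms of q', those of X^2YZ, XY^2Z, XYZ^2
    its squares, and the other nine the linear forms. *)
Lemma quart_curve (z : nat -> K) : supported 15 z ->
  exists w : nat -> {poly K},
  [/\ forall i, (w i).[0] = z i,
      forall s, supported 15 (fun i => (w i).[s])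
    & forall s, exists y, forall i, quartR base_point i + s * (w i).[s] = quartR y i].
Proof.
move=> sz.
(* v is a preimage of z under the differential at the base point. *)
pose E := z 9%N / 2; pose F := z 10%N / 2; pose G := z 11%N / 2.
pose A := z 12%N / 2 - E - F; pose B := z 13%N / 2 - E - G.
pose D := z 14%N / 2 - F - G.
pose v := nth 0 [:: A; B; D; E; F; G;
  z 0%N / 4; (z 3%N - 2 * A) / 4; (z 4%N - 2 * A) / 4;
  (z 5%N - 2 * B) / 4; z 1%N / 4; (z 6%N - 2 * B) / 4;
  (z 7%N - 2 * D) / 4; (z 8%N - 2 * D) / 4; z 2%N / 4].
pose y j : {poly K} := (base_point j)%:P + (v j)%:P * 'X.
pose P i := quartR y i - (quartR base_point i)%:P.
have Ph i s : (P i).[s] =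
    quartR (fun j => base_point j + v j * s) i - quartR base_point i.
  rewrite /P hornerD hornerN hornerC; congr (_ - _).
  apply: (@rmorph_quartR _ _ (horner_eval s)) => j.
  by rewrite /= /horner_eval hornerD hornerM !hornerC hornerX.
have P0 i : (P i)`_0 = 0.
  rewrite -horner_coef0 Ph; apply/eqP; rewrite subr_eq0; apply/eqP.
  by apply: (@rmorph_quartR _ _ idfun) => j; rewrite /= mulr0 addr0.
have y0 j : (y j).[0] = base_point j.
  by rewrite hornerD hornerM !hornerC hornerX mulr0 addr0.
have dy j : (y j)^`() = (v j)%:P.
  by rewrite derivD derivM !derivC derivX mul0r !add0r mulr1.
have dM a b : (y a * y b)^`().[0] = v a * base_point b + base_point a * v b.
  by rewrite derivM hornerD !hornerM !dy !y0 !hornerC.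
(* For m = 0 the multiple [*+ m] is 0, so the truncated exponent [m.-1] does no harm. *)
have dX m a : (y a ^+ m)^`().[0] = (base_point a ^+ m.-1 * v a) *+ m.
  by rewrite deriv_exp hornerMn hornerM horner_exp dy y0 hornerC mulrC.
have dX3 m n k a b c : (y a ^+ m * (y b ^+ n * y c ^+ k))^`().[0] =
    (base_point a ^+ m.-1 * v a) *+ m * (base_point b ^+ n * base_point c ^+ k) +
    base_point a ^+ m * ((base_point b ^+ n.-1 * v b) *+ n * base_point c ^+ k +
                   base_point b ^+ n * ((base_point c ^+ k.-1 * v c) *+ k)).
  by rewrite !(derivM, hornerD, hornerM) !dX !horner_exp !y0.
have P1 i : (P i)`_1 = z i.
  have -> : (P i)`_1 = (quartR y i)^`().[0].
    by rewrite horner_coef0 coef_deriv /P coefB coefC subr0.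
  rewrite /quartR /quart.
  do 15![case: i => [|i]; first by (
    cbn [nth]; rewrite ?(derivD, derivMn, hornerD, hornerMn, dX3, dM);
    rewrite /base_point /v; cbn [nth predn]; rewrite /A /B /D /E /F /G; field)].
  by rewrite sz // nth_default // deriv0 horner0.
(* As [P i] has constant coefficient 0, this is its quotient by the parameter, and the linear
   coefficient becomes the value at 0. *)
exists (fun i => drop_poly 1 (P i)).
have PE i : P i = drop_poly 1 (P i) * 'X.
  rewrite -{1}(poly_take_drop 1 (P i)) expr1 [take_poly 1 _](_ : _ = 0) ?add0r //.
  by apply/polyP => -[|k]; rewrite coef_take_poly coef0 ?P0.
split.
- by move=> i; rewrite horner_coef0 coef_drop_poly add0n P1.
- move=> s i le_i; rewrite [P i](_ : _ = 0) ?raddf0 ?horner0 //.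
  by rewrite /P ![quartR _ _]nth_default // polyC0 subr0.
- move=> s; exists (fun j => base_point j + v j * s) => i.
  rewrite mulrC -[X in _ * X](hornerX s) -hornerM -PE Ph.
  by rewrite addrC subrK.
Qed.

End Curves.

(** * Homogeneous ternary polynomials and their coefficients *)

Lemma mcoef0 (R : comNzRingType) n e : mcoef (0 : MP R n) e = 0.
Proof. by elim: n e => //= n IH e; rewrite coef0. Qed.

Lemma mcoef_ext0 (R : comNzRingType) n (p : MP R n) :
  (forall e, size e = n -> mcoef p e = 0) -> p = 0.
Proof.
elim: n p => [p H|n IH p H]; first exact: (H [::]).
apply/polyP => i; rewrite coef0.
by apply: IH => e se; apply: (H (i :: e)); rewrite /= se.
Qed.

Lemma homogE (R : comNzRingType) n (p : MP R n) d :
  homog p d <-> forall e, size e = n -> mcoef p e <> 0 -> sumn e = d.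
Proof.
elim: n p d => [|n IH] p d.
  split=> /= [/predU1P[-> [|//] _ _ //|/eqP-> e _] //|H].
  have [_|/eqP nz] := eqVneq (p : R) 0; first by rewrite orbT.
  by rewrite -(H [::]).
split=> [/allP H [//|i e] /= [se] nz|H].
  have [lt_i|le_i] := ltnP i (size (p : {poly MP R n})); last first.
    by case: nz; rewrite nth_default // mcoef0.
  have := H i; rewrite mem_iota lt_i => /(_ isT) /orP[/eqP E|/andP[le_id]].
    by case: nz; rewrite E mcoef0.
  by move/IH => /(_ e se nz)->; rewrite subnKC.
apply/allP => i _; have [//|/eqP nz /=] := eqVneq.
(* A nonzero coefficient polynomial has a nonzero monomial, whose degree forces [i <= d]. *)
have [e [se nze]] : exists e, size e = n /\ mcoef (p : {poly MP R n})`_i e <> 0.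
  apply: NNPP => h; apply: nz; apply: mcoef_ext0 => e se.
  by apply: NNPP => he; apply: h; exists e.
have Hi e' : size e' = n -> mcoef (p : {poly MP R n})`_i e' <> 0 -> (i + sumn e')%N = d.
  by move=> se' nze'; apply: (H (i :: e')); rewrite /= ?se'.
have id := Hi _ se nze; apply/andP; split; first by rewrite -id leq_addr.
by apply/IH => e' se' nze'; rewrite -(Hi _ se' nze') addKn.
Qed.

Section Ternary.
Variable R : comNzRingType.

(** The third exponent is forced by homogeneity, so [c] is indexed by the first two only. *)
Definition ternary (d : nat) (c : nat -> nat -> R) : MP R 3 :=
  \poly_(i < d.+1) \poly_(j < d.+1 - i) (c i j *: 'X^(d - i - j)).

Lemma mcoef_ternary d c i j k : mcoef (ternary d c) [:: i; j; k] =
  if (i + j + k == d)%N then c i j else 0.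
Proof.
rewrite /= coef_poly; case: ltnP => [lt_i|le_i]; last first.
  by rewrite !coef0; case: eqP => //; lia.
rewrite coef_poly; case: ltnP => [lt_j|le_j]; last first.
  by rewrite coef0; case: eqP => //; lia.
rewrite coefZ coefXn.
have -> : (i + j + k == d)%N = (k == d - i - j)%N by lia.
by case: eqP; rewrite ?mulr1 ?mulr0.
Qed.

Lemma homog_ternary d c : homog (ternary d c) d.
Proof.
apply/homogE => -[|i [|j [|k []]]] // _; rewrite mcoef_ternary.
by case: eqP => //= <-; rewrite addn0 addnA.
Qed.

Lemma ternary_mcoef d (p : MP R 3) : homog p d ->
  p = ternary d (fun i j => mcoef p [:: i; j; (d - i - j)%N]).
Proof.
move/homogE => H; apply/polyP => i; apply/polyP => j; apply/polyP => k.
apply: etrans (esym (mcoef_ternary d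
  (fun i j => mcoef p [:: i; j; (d - i - j)%N]) i j k)).
case: eqP => [<-|ne]; first by rewrite -addnA !addKn.
apply: NNPP => nz; apply: ne.
by have /= <- := H [:: i; j; k] erefl nz; rewrite addn0 addnA.
Qed.

End Ternary.

(** The list repeats the numbering of [y 0] to [y 5] in [quart]; [index] turns an exponent vector
    into its parameter. *)
Definition quad (R : comNzRingType) (y : nat -> R) : MP R 3 :=
  ternary 2 (fun i j => y (index [:: i; j; 2 - i - j]
    [:: [:: 2; 0; 0]; [:: 0; 2; 0]; [:: 0; 0; 2];
        [:: 1; 1; 0]; [:: 1; 0; 1]; [:: 0; 1; 1]])%N).

Definition lin (R : comNzRingType) (y : nat -> R) (a : nat) : MP R 3 :=
  ternary 1 (fun i j => y (a + (if i == 1 then 0 else if j == 1 then 1 else 2))%N).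

(** This certifies the formulas of [quart]. Abstract [X Y Z] keep the expansion within reach of
    [ring]; they are specialised to the actual variables later. *)
Lemma quartR_sum (A : comNzRingType) (y : nat -> A) (X Y Z : A) :
  \sum_(i < 15) quartR y i *
    (let e := nth 0%N (nth [::] quartic_exps i) in
     X ^+ e 0%N * Y ^+ e 1%N * Z ^+ e 2%N) =
  (y 0%N * X ^+ 2 + y 1%N * Y ^+ 2 + y 2%N * Z ^+ 2 +
     y 3%N * (X * Y) + y 4%N * (X * Z) + y 5%N * (Y * Z)) ^+ 2 +
  (y 6%N * X + y 7%N * Y + y 8%N * Z) ^+ 4 +
  (y 9%N * X + y 10%N * Y + y 11%N * Z) ^+ 4 +
  (y 12%N * X + y 13%N * Y + y 14%N * Z) ^+ 4.
Proof.
rewrite !(big_ord_recr, big_ord0) /=.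
rewrite /quartR /quart; cbn [nth].
ring.
Qed.

Section TernaryMonomials.
Variable R : comNzRingType.

Definition const3 : R -> MP R 3 := polyC \o (polyC \o polyC).
HB.instance Definition _ :=
  GRing.RMorphism.copy const3 (polyC \o (polyC \o polyC)).

(** [X1] is the outermost variable, since [mcoef] reads the outermost exponent first. *)
Definition X1 : MP R 3 := 'X.
Definition X2 : MP R 3 := 'X%:P.
Definition X3 : MP R 3 := 'X%:P%:P.

Lemma ternaryE d (c : nat -> nat -> R) : ternary d c =
  \sum_(i < d.+1) \sum_(j < d.+1 - i)
    const3 (c i j) * (X1 ^+ i * X2 ^+ j * X3 ^+ (d - i - j)).
Proof.
rewrite /ternary poly_def; apply: eq_bigr => i _.
rewrite poly_def -mul_polyC rmorph_sum mulr_suml; apply: eq_bigr => j _.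
rewrite -!mul_polyC !rmorphM /= !rmorphXn /= mulrC.
by rewrite /const3 /X1 /X2 /X3 /=; ring.
Qed.

Lemma quadE (y : nat -> R) (z := const3 \o y) : quad y =
  z 0%N * X1 ^+ 2 + z 1%N * X2 ^+ 2 + z 2%N * X3 ^+ 2 +
     z 3%N * (X1 * X2) + z 4%N * (X1 * X3) + z 5%N * (X2 * X3).
Proof.
rewrite /quad ternaryE; do 3!rewrite ?(big_ord_recr, big_ord0) /subn /=.
move: X1 X2 X3 => X Y Z; rewrite /z /=; ring.
Qed.

Lemma linE (y : nat -> R) a (z := const3 \o y) :
  lin y a = z a * X1 + z a.+1 * X2 + z a.+2 * X3.
Proof.
rewrite /lin ternaryE; do 3!rewrite ?(big_ord_recr, big_ord0) /subn /=.
rewrite addn0 addn1 addn2.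
move: X1 X2 X3 => X Y Z; rewrite /z /=; ring.
Qed.

Lemma ternary_quartR (y : nat -> R) :
  ternary 4 (fun i j => quartR y (index [:: i; j; 4 - i - j]%N quartic_exps)) =
  quad y ^+ 2 + lin y 6 ^+ 4 + lin y 9 ^+ 4 + lin y 12 ^+ 4.
Proof.
rewrite quadE !linE -quartR_sum ternaryE.
do 3!rewrite ?(big_ord_recr, big_ord0) /subn /=.
rewrite !(@rmorph_quartR _ _ const3 y (const3 \o y)) //.
move: X1 X2 X3 (quartR _) => X Y Z f; ring.
Qed.

End TernaryMonomials.

(** * From formal terms to polynomial functions, and the conclusion *)

Fixpoint pfun_of_term (R : comUnitRingType) (es : seq (seq nat))
    (t : GRing.term R) : pfun R :=
  match t with
  | GRing.Var i => if (i < size es)%N then PCoef R (nth [::] es i) else PConst 0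
  | GRing.Const c => PConst c
  | GRing.NatConst n => PConst n%:R
  | GRing.Add t1 t2 => PAdd (pfun_of_term es t1) (pfun_of_term es t2)
  | GRing.Opp t1 => PMul (PConst (-1)) (pfun_of_term es t1)
  | GRing.NatMul t1 n => PMul (PConst n%:R) (pfun_of_term es t1)
  | GRing.Mul t1 t2 => PMul (pfun_of_term es t1) (pfun_of_term es t2)
  | GRing.Inv _ => PConst 0
  | GRing.Exp t1 n => iter n (PMul (pfun_of_term es t1)) (PConst 1)
  end.

Lemma peval_pfun_of_term (R : comUnitRingType) n es t (p : MP R n) :
  peval (pfun_of_term es t) p = teval id (nth 0 [seq mcoef p e | e <- es]) t.
Proof.
elim: t => //= [i|t1 -> t2 ->|t ->|t IH m|t1 -> t2 ->|t IH m] //=.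
- case: ltnP => [lt_i|le_i]; first by rewrite (nth_map [::]).
  by rewrite nth_default ?size_map.
- by rewrite mulN1r.
- by rewrite IH mulr_natl.
- by elim: m => [|m IHm] /=; rewrite ?expr0 // exprS IHm IH.
Qed.

Lemma quart_open (C : numClosedFieldType) :
  exists G : GRing.term C,
    (exists2 x, supported 15 x & teval id x G != 0) /\
    (forall x, supported 15 x -> teval id x G != 0 ->
       exists y, forall i, (i < 15)%N -> x i = quartR y i).
Proof.
have [D rD DP] := closed_field_qe (quart_formula_rformula C).
have evE (x : nat -> C) (t : GRing.term C) : supported 15 x -> GRing.rterm t ->
    GRing.eval (mkseq x 15) t = teval id x t.
  move=> sx rt; rewrite eval_teval //; apply: eq_teval => i.
  have [lt_i|le_i] := ltnP i 15; first by rewrite nth_mkseq.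
  by rewrite nth_default ?size_mkseq // sx.
have DE x : supported 15 x ->
    has (fun bc => all (fun t => teval id x t == 0) bc.1 &&
                   all (fun t => teval id x t != 0) bc.2) D <->
    exists y, forall i, (i < 15)%N -> x i = quartR y i.
  move=> sx; rewrite -quart_formulaP DP.
  suff -> : has (fun bc => all (fun t => teval id x t == 0) bc.1 &&
                   all (fun t => teval id x t != 0) bc.2) D =
     has (fun bc => all (fun t => GRing.eval (mkseq x 15) t == 0) bc.1 &&
                   all (fun t => GRing.eval (mkseq x 15) t != 0) bc.2) D by [].
  have evA (a b : pred C) ts : a =1 b -> all (@GRing.rterm C) ts ->
      all (fun t => a (teval id x t)) ts =
      all (fun t => b (GRing.eval (mkseq x 15) t)) ts.
    by move=> ab; elim: ts => //= t ts IH /andP[rt /IH->]; rewrite ab evE.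
  elim: (D) rD => //= bc D' IH /andP[/andP[r1 r2] /IH->].
  by rewrite (evA (pred1 0) (pred1 0)) // (evA (predC1 0) (predC1 0)).
have [G [rG [x0 sx0 nz0] [HG|HG]]] := dnf_dichotomy 15 rD.
  exists G; split; first by exists x0.
  by move=> x sx nz; apply/DE => //; apply: HG.
(* In the remaining case [G] vanishes on the image, hence everywhere by density, against its nonzero
   value at [x0]. *)
case/eqP: nz0.
apply: (@dense_of_curves C 15 (fun x => exists y, x =1 quartR y)
  (quartR (base_point C))) => //.
- by move=> i le_i; rewrite [quartR _ _]nth_default.
- move=> z sz; have [w [w0 sw hw]] := quart_curve sz; by exists w.
- move=> x [y xy]; apply: HG.
    by move=> i le_i; rewrite xy [quartR _ _]nth_default.
  apply/DE; last by exists y => i _.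
  by move=> i le_i; rewrite xy [quartR _ _]nth_default.
Qed.

Theorem theorem1p10 (C : numClosedFieldType) :
  general C 3 4 (fun p : MP C 3 =>
    exists (q l1 l2 l3 : MP C 3),
      [/\ homog q 2, homog l1 1, homog l2 1, homog l3 1
        & p = q ^+ 2 + l1 ^+ 4 + l2 ^+ 4 + l3 ^+ 4]).
Proof.
have [G [[x0 sx0 nz0] HG]] := quart_open C.
have supp (p : MP C 3) :
    supported 15 (nth 0 [seq mcoef p e | e <- quartic_exps]).
  by move=> i le_i; rewrite nth_default ?size_map.
exists [:: pfun_of_term quartic_exps G]; split.
  (* The quartic with coefficient vector [x0] shows that the open set is nonempty. *)
  exists (ternary 4 (fun i j => x0 (index [:: i; j; 4 - i - j]%N quartic_exps))).
  split; first exact: homog_ternary.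
  rewrite /= orbF peval_pfun_of_term.
  rewrite (@eq_teval _ _ x0) // => i.
  have [lt_i|le_i] := ltnP i 15; last by rewrite supp // sx0.
  rewrite (nth_map [::]) //.
  by do 15![case: i lt_i => [|i] lt_i; first by rewrite mcoef_ternary].
move=> p [hp]; rewrite /= orbF peval_pfun_of_term => nz.
have [y Hy] := HG _ (supp p) nz.
exists (quad y), (lin y 6), (lin y 9), (lin y 12).
split; try exact: homog_ternary.
rewrite -ternary_quartR [LHS](ternary_mcoef hp).
rewrite !ternaryE; apply: eq_bigr => i _; apply: eq_bigr => j _.
congr (const3 _ * _).
(* Every exponent vector of degree 4 is listed, so [index] stays below 15 and [Hy] applies. *)
have e_in : [:: val i; val j; 4 - i - j]%N \in quartic_exps.
  by case: i j => [[|[|[|[|[|?]]]]] // ?] [[|[|[|[|[|?]]]]] // ?].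
rewrite -Hy; last by move: e_in; rewrite -index_mem.
by rewrite (nth_map [::]) ?index_mem // nth_index.
Qed.
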